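(* Let $G$ be a triangulated graph of order $n\ge 1$, with chromatic number $\chi(G)$ and maximum degree $\Delta(G)$. Then: (i) $\mathcal{A}(G)\ge \mathcal{A}\big(K_{\chi(G)}\cup (n-\chi(G))K_1\big)$, with equality if and only if $G\simeq K_{\chi(G)}\cup (n-\chi(G))K_1$; (ii) $\mathcal{A}(G)\ge \mathcal{A}\big(K_{1,\Delta(G)}\cup (n-\Delta(G)-1)K_1\big)$, with equality if and only if $G\simeq K_{1,\Delta(G)}\cup (n-\Delta(G)-1)K_1$; (iii) consequently $\mathcal{A}(G)\ge \mathcal{A}(E_n)$, with equality if and only if $G\simeq E_n$.
   Context: All graphs are finite, simple and undirected. A coloring of a graph $G$ assigns colors to its vertices so that adjacent vertices receive different colors; two colorings are equivalent if they induce the same partition of the vertex set into color classes. For $k\ge 1$, $S(G,k)$ denotes the number of non-equivalent colorings of $G$ using exactly $k$ colors (i.e. the number of partitions of $V(G)$ into exactly $k$ nonempty stable sets). Set $\mathcal{B}(G)=\sum_{k\ge1}S(G,k)$, $\mathcal{T}(G)=\sum_{k\ge1}kS(G,k)$ and $\mathcal{A}(G)=\mathcal{T}(G)/\mathcal{B}(G)$, the average number of colors in the non-equivalent colorings of $G$. A vertex is simplicial if its neighbors induce a clique; a graph is triangulated if each of its induced subgraphs contains a simplicial vertex. $K_n$ is the complete graph, $E_n$ the empty (edgeless) graph of order $n$, $K_{a,b}$ the complete bipartite graph with parts of sizes $a,b$ (so $K_{1,0}=K_1$), $G_1\cup G_2$ the disjoint union, and $pK_1$ denotes $p$ isolated vertices.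 *)

(* Defs.v *)
From mathcomp Require Import all_boot all_order all_algebra.

Set Implicit Arguments.
Unset Strict Implicit.
Unset Printing Implicit Defensive.

Import Order.TTheory GRing.Theory Num.Theory.

Record sgraph := SGraph {
  vertex :> finType;
  adj : rel vertex;
  adj_sym : symmetric adj;
  adj_irr : irreflexive adj }.

Definition isomorphic (G H : sgraph) : Prop :=
  exists2 f : G -> H, bijective f & forall x y, adj (f x) (f y) = adj x y.

Section Constructions.

Lemma complete_sym (n : nat) : symmetric (fun x y : 'I_n => x != y).
Proof. by move=> x y; rewrite eq_sym. Qed.

Lemma complete_irr (n : nat) : irreflexive (fun x y : 'I_n => x != y).
Proof. by move=> x; rewrite eqxx. Qed.

Definition complete (n : nat) : sgraph :=
  SGraph (@complete_sym n) (@complete_irr n).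

Lemma edgeless_sym (n : nat) : symmetric (fun _ _ : 'I_n => false).
Proof. by []. Qed.

Lemma edgeless_irr (n : nat) : irreflexive (fun _ _ : 'I_n => false).
Proof. by []. Qed.

(* Serves both as E_n and as n K_1; n = 0 gives the null graph, the neutral
   element of disjoint union. *)
Definition edgeless (n : nat) : sgraph :=
  SGraph (@edgeless_sym n) (@edgeless_irr n).

Definition bip_adj (a b : nat) (x y : 'I_a + 'I_b) : bool :=
  match x, y with
  | inl _, inr _ | inr _, inl _ => true
  | _, _ => false
  end.

Lemma bip_sym (a b : nat) : symmetric (@bip_adj a b).
Proof. by case=> x [] y. Qed.

Lemma bip_irr (a b : nat) : irreflexive (@bip_adj a b).
Proof. by case. Qed.

Definition complete_bipartite (a b : nat) : sgraph :=
  SGraph (@bip_sym a b) (@bip_irr a b).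

Definition union_adj (G H : sgraph) (x y : G + H) : bool :=
  match x, y with
  | inl u, inl v => adj u v
  | inr u, inr v => adj u v
  | _, _ => false
  end.

Lemma union_sym (G H : sgraph) : symmetric (@union_adj G H).
Proof. by case=> x [] y //=; rewrite adj_sym. Qed.

Lemma union_irr (G H : sgraph) : irreflexive (@union_adj G H).
Proof. by case=> x /=; rewrite adj_irr. Qed.

Definition disjoint_union (G H : sgraph) : sgraph :=
  SGraph (@union_sym G H) (@union_irr G H).

Definition induced_adj (G : sgraph) (A : {set G}) : rel {x : G | x \in A} :=
  fun x y => adj (val x) (val y).

Lemma induced_sym (G : sgraph) (A : {set G}) : symmetric (@induced_adj G A).
Proof. by move=> x y; rewrite /induced_adj adj_sym. Qed.

Lemma induced_irr (G : sgraph) (A : {set G}) : irreflexive (@induced_adj G A).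
Proof. by move=> x; rewrite /induced_adj adj_irr. Qed.

Definition induced (G : sgraph) (A : {set G}) : sgraph :=
  SGraph (@induced_sym G A) (@induced_irr G A).

End Constructions.

Section Invariants.

Variable G : sgraph.

Definition neighbors (v : G) : {set G} := [set w | adj v w].

Definition max_degree : nat := \max_(v : G) #|neighbors v|.

Definition clique (A : {set G}) : bool :=
  [forall x in A, forall y in A, (x != y) ==> adj x y].

Definition stable (A : {set G}) : bool :=
  [forall x in A, forall y in A, ~~ adj x y].

Definition simplicial (v : G) : bool := clique (neighbors v).

Definition proper_coloring (k : nat) (c : {ffun G -> 'I_k}) : bool :=
  [forall x, forall y, adj x y ==> (c x != c y)].

Definition colorable (k : nat) : bool :=
  [exists c : {ffun G -> 'I_k}, proper_coloring c].

Lemma ex_colorable : exists k, colorable k.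
Proof.
exists #|G|; apply/existsP; exists [ffun x => enum_rank x].
apply/forallP=> x; apply/forallP=> y; apply/implyP=> xy; rewrite !ffunE.
apply/eqP=> /enum_rank_inj exy.
by rewrite exy adj_irr in xy.
Qed.

Definition chromatic_number : nat := ex_minn ex_colorable.

(* S(G, k); [partition] already requires the classes to be nonempty. *)
Definition stable_partitions (k : nat) : {set {set {set G}}} :=
  [set P | [&& partition P [set: G], #|P| == k & [forall A in P, stable A]]].

Definition num_colorings (k : nat) : nat := #|stable_partitions k|.

Lemma num_colorings_gt (k : nat) : #|G| < k -> num_colorings k = 0.
Proof.
move=> ltGk; apply/eqP; rewrite cards_eq0; apply/eqP/setP=> P.
rewrite !inE; apply/negbTE/negP=> /and3P[partP /eqP cardP _].
have /and3P[_ _ nP0] := partP.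
have := card_partition partP; rewrite cardsT => cardG.
suff: k <= #|G| by rewrite leqNgt ltGk.
rewrite cardG -cardP -sum1_card; apply: leq_sum => A AP.
by rewrite card_gt0; apply: contraNneq nP0 => <-.
Qed.

(* By [num_colorings_gt], stopping the sums over k >= 1 at #|G| loses
   nothing. *)
Definition total_colorings : nat :=
  \sum_(1 <= k < #|G|.+1) num_colorings k.

Definition total_colors : nat :=
  \sum_(1 <= k < #|G|.+1) k * num_colorings k.

Definition avg_colors : rat := (total_colors%:R / total_colorings%:R)%R.

End Invariants.

(* "Each induced subgraph" means each one with at least one vertex. *)
Definition triangulated (G : sgraph) : Prop :=
  forall A : {set G}, A != set0 -> exists v : induced A, simplicial v.

(* Main.v *)
(** Eliminating simplicial vertices one at a time, with [d_i] neighbors left at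
    the [i]-th step, gives the chromatic polynomial [P(x) = \prod_i (x - d_i)],
    and [P(x) = \sum_k S(G, k) x^_k].  Let [L] be the expectation under the law
    of the number of fixed points of a uniform permutation of [N] points.  Since
    [L(x^_k) = 1] for [k <= N], we get [B(G) = L(P)] and
    [B(G) + T(G) = L(x P)], so that [A(G) + 1 = L(x P) / L(P)].  Writing
    [P = (x - d) Q], this ratio is strictly increasing in [d] as long as [Q] is
    nonnegative on the naturals and vanishes below [d]: this is the strict
    Cauchy-Schwarz inequality [L(x Q)^2 < L(Q) L(x^2 Q)].  Every [d_i] can thus
    be lowered, in a suitable order, down to the degrees of the extremal graph.
    In the equality case the sums of the [d_i], hence the numbers of edges,
    agree, and [G] contains the extremal graph. *)

Require Import Defs.
From mathcomp Require Import all_boot all_order all_algebra.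
From mathcomp Require Import zify ring lra.

Set Implicit Arguments.
Unset Strict Implicit.
Unset Printing Implicit Defensive.

Import Order.TTheory GRing.Theory Num.Theory.

(** * Moments of the fixed-point law *)

(* The pair [(D_n, D_(n+1))] of derangement numbers. *)
Fixpoint derangements2 (n : nat) : nat * nat :=
  if n is m.+1 then
    let: (a, b) := derangements2 m in (b, m.+1 * (a + b))
  else (1, 0).

Definition derangements (n : nat) : nat := (derangements2 n).1.

Lemma derangementsS (n : nat) :
  derangements n.+2 = n.+1 * (derangements n + derangements n.+1).
Proof. by rewrite /derangements /=; case: (derangements2 n). Qed.

(** Permutations are classified by their set of non-fixed points. In terms of the recurrence,
    Pascal's rule gives [FS], the derangement recurrence gives [F1S], and together they yield
    [F m.+2 = m.+2 * F m.+1]. *)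
Lemma sum_bin_derangements (n : nat) :
  \sum_(k < n.+1) 'C(n, k) * derangements k = n`!.
Proof.
pose F m := \sum_(k < m.+1) 'C(m, k) * derangements k.
pose F1 m := \sum_(k < m.+1) 'C(m, k) * derangements k.+1.
have FS m : F m.+1 = F m + F1 m.
  rewrite /F /F1 big_ord_recl bin0 mul1n.
  under eq_bigr => i _ do rewrite lift0 binS mulnDl.
  rewrite big_split /= addnA; congr (_ + _).
  rewrite [RHS]big_ord_recl bin0 mul1n big_ord_recr /= (@bin_small m) // mul0n addn0.
  by congr (_ + _); apply: eq_bigr => i _; rewrite lift0.
have F1S m : F1 m.+1 = m.+1 * F m.+1.
  rewrite FS /F1 big_ord_recl /= muln0 add0n.
  rewrite /F -big_split big_distrr /=; apply: eq_bigr => i _.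
  by rewrite ?lift0 derangementsS -mulnDr mulnCA [RHS]mulnA (mul_bin_diag m.+1) mulnA.
elim: n => [|[|n] IHn]; first by rewrite big_ord1.
  by rewrite !big_ord_recr big_ord0.
by rewrite -/(F n.+2) FS F1S /F IHn factS mulSn.
Qed.

(* Up to the factor [N`!], the expectation of [f] at the number of fixed points
   of a uniform permutation of [N] points. *)
Definition moment (N : nat) (f : nat -> nat) : nat :=
  \sum_(k < N.+1) 'C(N, k) * derangements (N - k) * f k.

Lemma eq_moment (N : nat) (f g : nat -> nat) : f =1 g -> moment N f = moment N g.
Proof. by move=> fg; apply: eq_bigr => k _; rewrite fg. Qed.

(** Double counting of permutations with an ordered choice of [i] distinct fixed points: once these
    are chosen in [N ^_ i] ways, any permutation of the other [N - i] points completes them. *)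
Lemma moment_ffact (N i : nat) : i <= N -> moment N (fun k => k ^_ i) = N`!.
Proof.
move=> leiN; have -> : N`! = N ^_ i * (N - i)`! by rewrite ffact_fact.
rewrite -sum_bin_derangements big_distrr /=.
rewrite /moment -(big_mkord xpredT (fun k => 'C(N, k) * derangements (N - k) * k ^_ i)).
rewrite (big_cat_nat (n := i)) //=; last by rewrite leqW.
rewrite big_nat_cond big1 ?add0n; last first.
  by move=> k /andP[/andP[_ ki] _]; rewrite ffact_small ?muln0.
rewrite -{1}(add0n i) big_addn subSn // big_mkord.
(* After the shift by [i] and this reversal, [k] counts the non-fixed points, as in
   [sum_bin_derangements]. *)
rewrite (reindex_inj rev_ord_inj) /=; apply: eq_bigr => k _.
have kle : k <= N - i by rewrite -ltnS.
have -> : (N - i).+1 - k.+1 = N - i - k by [].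
have e1 : N - (N - i - k + i) = k by lia.
rewrite e1 mulnAC mulnA; congr (_ * _).
apply/eqP; rewrite -(eqn_pmul2r (fact_gt0 k)) -(eqn_pmul2r (fact_gt0 (N - i - k))).
have e2 : 'C(N, N - i - k + i) * (N - i - k + i) ^_ i * k`! * (N - i - k)`! = N`!.
  rewrite -[RHS](@bin_fact _ (N - i - k + i)); last by lia.
  rewrite e1 -(ffact_fact (leq_addl (N - i - k) i)) addnK.
  by rewrite -!mulnA [k`! * _]mulnC.
rewrite e2 -!mulnA (bin_fact kle) ffact_fact //.
Qed.

(* The subtraction is truncated; [root_prod d] agrees on the naturals with the
   polynomial of roots [d] as soon as every number below an entry of [d] is also
   an entry of [d]. *)
Definition root_prod (d : seq nat) (x : nat) : nat := \prod_(i <- d) (x - i).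

(** The factorial factor of [moment] cancels: this is the mean number of fixed points under the law
    reweighted by [root_prod d]. *)
Definition mean (N : nat) (d : seq nat) : rat :=
  ((moment N (fun k => k * root_prod d k))%:R / (moment N (root_prod d))%:R)%R.

Lemma perm_mean (N : nat) (d e : seq nat) : perm_eq d e -> mean N d = mean N e.
Proof.
move=> de; have deE : root_prod d =1 root_prod e by move=> x; apply: perm_big.
by rewrite /mean (eq_moment _ deE); congr (_%:R / _)%R; apply: eq_moment => k; rewrite deE.
Qed.

Lemma root_prod_gt0 (d : seq nat) (x : nat) :
  (0 < root_prod d x) = all (ltn^~ x) d.
Proof.
rewrite /root_prod; elim: d => [|i d IHd]; first by rewrite big_nil.
by rewrite big_cons muln_gt0 subn_gt0 IHd.
Qed.

Lemma root_prod_eq0 (d : seq nat) (x : nat) : x \in d -> root_prod d x = 0.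
Proof.
move=> xd; apply/eqP; rewrite -leqn0 leqNgt root_prod_gt0.
by apply/negP => /allP/(_ x xd) /=; rewrite ltnn.
Qed.

Lemma moment_gt0 (N : nat) (f : nat -> nat) : 0 < f N -> 0 < moment N f.
Proof.
by move=> fN; rewrite /moment big_ord_recr /= binn subnn muln1 addn_gt0 mul1n fN orbT.
Qed.

(** * Strict Cauchy-Schwarz and monotonicity of the mean in one root *)

Section CauchySchwarz.

Local Open Scope ring_scope.

(** The difference of the two sides, times [m0], is the weighted sum of the squares of
    [k * m0 - m1], which cannot vanish at two distinct points of positive weight. *)
Lemma variance_gt0 (N : nat) (p : nat -> rat) (a b : 'I_N) :
    (forall k : 'I_N, 0 <= p k) -> (a != b)%N -> 0 < p a -> 0 < p b ->
  (\sum_(k < N) p k * k%:R) ^+ 2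
    < (\sum_(k < N) p k) * (\sum_(k < N) p k * k%:R ^+ 2).
Proof.
move=> p0 ab pa pb.
set m0 := \sum_(k < N) p k; set m1 := \sum_(k < N) _ * _; set m2 := \sum_(k < N) _ * _.
have m0_gt0 : 0 < m0.
  by rewrite /m0 (bigD1 a) //= ltr_pwDl // sumr_ge0.
have E : \sum_(k < N) p k * (k%:R * m0 - m1) ^+ 2 = m0 * (m0 * m2 - m1 ^+ 2).
  have lin x y z : \sum_(k < N) p k * (x * k%:R ^+ 2 + y * k%:R + z) = x * m2 + y * m1 + z * m0.
    by rewrite !mulr_sumr -!big_split; apply: eq_bigr => k _ /=; ring.
  transitivity (m0 ^+ 2 * m2 + (- 2 * m0 * m1) * m1 + m1 ^+ 2 * m0); last by ring.
  by rewrite -lin; apply: eq_bigr => k _; ring.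
have : 0 < \sum_(k < N) p k * (k%:R * m0 - m1) ^+ 2.
  have ge0 (k : 'I_N) : 0 <= p k * (k%:R * m0 - m1) ^+ 2.
    by rewrite mulr_ge0 // sqr_ge0.
  rewrite lt_neqAle sumr_ge0 // andbT eq_sym; apply/negP => /eqP S0.
  have /= Z := psumr_eq0P (fun k _ => ge0 k) S0.
  have: a%:R * m0 = b%:R * m0 :> rat.
    have /eqP := Z a isT; have /eqP := Z b isT.
    rewrite !(mulf_eq0 (p _)) !expf_eq0 /= !subr_eq0 !(gt_eqF pa) !(gt_eqF pb) /=.
    by move=> /eqP -> /eqP ->.
  move/(mulIf (lt0r_neq0 m0_gt0))/eqP; rewrite eqr_nat => /eqP/val_inj abE.
  by rewrite abE eqxx in ab.
by rewrite E pmulr_rgt0 // subr_gt0.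
Qed.

End CauchySchwarz.

(** As a function of the root [z], the mean is the homography [(m2 - z * m1) / (m1 - z * m0)], and
    it increases because [m1 ^+ 2 < m0 * m2]. *)
Lemma mean_lt (N x y : nat) (q : seq nat) :
    all (ltn^~ N) (x :: q) -> y < x -> {subset iota 0 x <= q} ->
  (mean N.+2 (y :: q) < mean N.+2 (x :: q))%R.
Proof.
move=> /= /andP[xN qN] yx xq.
pose p k : rat := (('C(N.+2, k) * derangements (N.+2 - k)) * root_prod q k)%:R%R.
pose m0 : rat := (\sum_(k < N.+3) p k)%R.
pose m1 : rat := (\sum_(k < N.+3) p k * k%:R)%R.
pose m2 : rat := (\sum_(k < N.+3) p k * k%:R ^+ 2)%R.
(* Truncation matters only for [k < z], but then [k] is an entry of [q] and the weight [p k]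
   vanishes. *)
have pE z k : z <= x -> (p k * (k - z)%:R = p k * (k%:R - z%:R))%R.
  move=> zx; have [zk|kz] := leqP z k; first by rewrite natrB.
  rewrite /p root_prod_eq0 ?muln0 ?mul0r //; apply: xq.
  by rewrite mem_iota /= add0n (leq_trans kz).
have M0 z : z <= x -> ((moment N.+2 (root_prod (z :: q)))%:R = m1 - z%:R * m0)%R.
  move=> zx; rewrite /moment natr_sum mulr_sumr -sumrB; apply: eq_bigr => k _.
  rewrite {1}/root_prod big_cons -/(root_prod q k) mulnCA mulnC natrM (pE _ _ zx).
  by ring.
have M1 z : z <= x ->
    ((moment N.+2 (fun k => k * root_prod (z :: q) k))%:R = m2 - z%:R * m1)%R.
  move=> zx; rewrite /moment natr_sum mulr_sumr -sumrB; apply: eq_bigr => k _.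
  rewrite {1}/root_prod big_cons -/(root_prod q k).
  have -> : 'C(N.+2, k) * derangements (N.+2 - k) * (k * ((k - z) * root_prod q k)) =
    ('C(N.+2, k) * derangements (N.+2 - k) * root_prod q k) * (k - z) * k by ring.
  by rewrite natrM natrM (pE _ _ zx); ring.
have pos z : z <= x -> (0 < m1 - z%:R * m0)%R.
  move=> zx; rewrite -M0 // ltr0n moment_gt0 // root_prod_gt0 /=.
  apply/andP; split; first by rewrite (leq_ltn_trans zx) // ltnS ltnW // ltnW.
  by apply: sub_all qN => i /= iN; rewrite ltnS ltnW // ltnW.
have var : (m1 ^+ 2 < m0 * m2)%R.
  (* The two atoms are [N] and [N.+2], both above every entry of [q]. The value [N.+1] has weight
     zero, since no permutation has exactly one non-fixed point; hence the shift by two. *)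
  have ltN : N < N.+3 by rewrite ltnS ltnW.
  apply: (@variance_gt0 _ p (Ordinal ltN) ord_max) => //=.
  - by apply/eqP=> /(congr1 val) /=; lia.
  - rewrite /p -[N.+2]addn2 addKn muln1 ltr0n !muln_gt0 bin_gt0 leq_addr /=.
    by rewrite root_prod_gt0.
  - rewrite /p subnn binn mul1n mul1n ltr0n root_prod_gt0.
    by apply: sub_all qN => i /= iN; rewrite ltnS ltnW // ltnW.
have yx' : (y%:R < x%:R :> rat)%R by rewrite ltr_nat.
rewrite /mean !M0 ?M1 ?(ltnW yx) //.
rewrite ltr_pdivrMr ?pos ?(ltnW yx) // mulrAC ltr_pdivlMr ?pos //.
nra.
Qed.

(** * Colorings and stable partitions *)

Definition kernel_colorings (G : sgraph) (x : nat) (P : {set {set G}}) :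
    {set {ffun G -> 'I_x}} :=
  [set c : {ffun G -> 'I_x} |
    [forall u, forall v, (c u == c v) == (pblock P u == pblock P v)]].

(** The chromatic polynomial of [G], evaluated at [x]. *)
Definition colorings (G : sgraph) (x : nat) : nat :=
  #|[set c : {ffun G -> 'I_x} | proper_coloring c]|.

(** A coloring whose classes are the blocks of [P] amounts to an injection of the blocks into the
    colors. *)
Lemma card_kernel_colorings (G : sgraph) (x : nat) (P : {set {set G}}) :
  partition P [set: G] -> #|kernel_colorings x P| = x ^_ #|P|.
Proof.
move=> partP; have /and3P[/eqP covP trivP P0] := partP.
have blP v : pblock P v \in P by rewrite pblock_mem // covP inE.
pose bl v : {B | B \in P} := exist (fun B => is_true (B \in P)) _ (blP v).
pose lift_col (f : {ffun {B | B \in P} -> 'I_x}) : {ffun G -> 'I_x} := [ffun v => f (bl v)].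
have bl_surj B : exists v, bl v == B.
  case: B => B BP; have /set0Pn[v vB] : B != set0 by apply: contraNneq P0 => <-.
  by exists v; apply/eqP/val_inj; apply: def_pblock.
have lift_inj : injective lift_col.
  move=> f g /ffunP fg; apply/ffunP=> B; have [v /eqP <-] := bl_surj B.
  by have := fg v; rewrite !ffunE.
have blE u v : (bl u == bl v) = (pblock P u == pblock P v) by [].
rewrite -[#|P|]card_sig -[x in RHS]card_ord -card_inj_ffuns.
rewrite -(card_imset _ lift_inj); apply: eq_card => c.
apply/idP/imsetP => [|[f]].
  rewrite inE => /forallP cP.
  have cE u v : (c u == c v) = (bl u == bl v).
    by have /forallP/(_ v)/eqP := cP u; rewrite blE.
  pose f := [ffun B => c (xchoose (bl_surj B))].
  have fE v : f (bl v) = c v.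
    by rewrite ffunE; apply/eqP; rewrite cE (xchooseP (bl_surj (bl v))).
  exists f; last by apply/ffunP => v; rewrite ffunE fE.
  rewrite inE; apply/injectiveP => B C.
  have [u /eqP <-] := bl_surj B; have [v /eqP <-] := bl_surj C.
  by rewrite !fE => /eqP; rewrite cE => /eqP.
rewrite inE => /injectiveP finj ->; rewrite inE.
by apply/forallP=> u; apply/forallP=> v; rewrite !ffunE (inj_eq finj) blE.
Qed.

(** Proper colorings are grouped by their partition into color classes; properness of the coloring
    is stability of the blocks. *)
Lemma colorings_ffact (G : sgraph) (x : nat) :
  colorings G x = \sum_(k < #|G|.+1) num_colorings G k * x ^_ k.
Proof.
pose SP := [set P : {set {set G}} | partition P [set: G] & [forall A in P, stable A]].
have kerP (c : {ffun G -> 'I_x}) (P : {set {set G}}) : partition P [set: G] ->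
    (c \in kernel_colorings x P) = (preim_partition c [set: G] == P).
  move=> partP; have /and3P[/eqP covP trivP P0] := partP.
  rewrite inE; apply/forallP/eqP => [cP | <- u].
    rewrite -[RHS](preim_partition_pblock partP); apply: eq_imset => u.
    by apply/setP=> v; rewrite !inE /=; have /forallP/(_ v)/eqP := cP u.
  apply/forallP=> v; apply/eqP; rewrite eq_pblock.
  - rewrite pblock_equivalence_partition ?inE //.
    by move=> a b d _ _ _; split=> // /eqP ->.
  - by have /and3P[] := preim_partitionP c [set: G].
  - by have /and3P[/eqP -> _ _] := preim_partitionP c [set: G].
have properP (c : {ffun G -> 'I_x}) :
    proper_coloring c = (preim_partition c [set: G] \in SP).
  rewrite inE preim_partitionP /=; apply/idP/forallP => [pc A | stab].
    apply/implyP => /imsetP[u _ ->].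
    apply/forallP => a; apply/implyP; rewrite !inE /= => /eqP ua.
    apply/forallP => b; apply/implyP; rewrite !inE /= => /eqP ub.
    move/forallP/(_ a)/forallP/(_ b): pc; rewrite -ua -ub eqxx implybF //.
  apply/forallP=> a; apply/forallP=> b; apply/implyP=> ab; apply/negP=> cab.
  pose A := [set v in [set: G] | c a == c v].
  have AP : A \in preim_partition c [set: G] by apply: imset_f; rewrite inE.
  have /implyP/(_ AP)/forallP/(_ a) := stab A; rewrite !inE eqxx /=.
  by move/forallP/(_ b); rewrite !inE cab ab.
rewrite /colorings -sum1_card.
under eq_bigl => c do rewrite inE properP.
rewrite (partition_big (fun c : {ffun G -> 'I_x} => preim_partition c [set: G]) (mem SP)) //=.
have cardP P : P \in SP -> #|P| < #|G|.+1.
  rewrite inE => /andP[partP stabP]; rewrite ltnNge; apply/negP => /num_colorings_gt/eqP.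
  by rewrite cards_eq0 => /eqP/setP/(_ P); rewrite !inE partP eqxx stabP.
transitivity (\sum_(P in SP) x ^_ #|P|).
  apply: eq_bigr => P PSP; have:= PSP; rewrite inE => /andP[partP _].
  rewrite -card_kernel_colorings // -sum1_card; apply: eq_bigl => c.
  by rewrite kerP //; case: eqP => [->|]; rewrite ?andbF // PSP.
rewrite (partition_big (fun P : {set {set G}} => inord #|P| : 'I_#|G|.+1) xpredT) //=.
apply: eq_bigr => k _; rewrite /num_colorings -sum_nat_const.
apply: eq_big => [P | P /andP[PSP /eqP <-]]; last by rewrite inordK // cardP.
apply/andP/idP => [[PSP /eqP <-] | ].
  by rewrite inE inordK ?cardP // eqxx; move: PSP; rewrite inE => /andP[-> ->].
rewrite inE => /and3P[partP /eqP cardP' stabP]; split; first by rewrite inE partP.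
by apply/eqP/val_inj; rewrite /= inordK cardP'.
Qed.

(** * Averages of colors as quotients of moments *)

Lemma momentD (N : nat) (f g : nat -> nat) :
  moment N (fun x => f x + g x) = moment N f + moment N g.
Proof. by rewrite /moment -big_split; apply: eq_bigr => k _; rewrite mulnDr. Qed.

(** Linearity and [moment_ffact]. The shift [j] is 0 or 1, the latter for the terms raised by the
    factor [x]. *)
Lemma moment_sum_ffact (N n j : nat) (a : nat -> nat) : n + j <= N ->
  moment N (fun x => \sum_(k < n.+1) a k * x ^_ (k + j))
    = N`! * \sum_(k < n.+1) a k.
Proof.
move=> njN; rewrite /moment; under eq_bigr => x _ do rewrite big_distrr /=.
rewrite exchange_big big_distrr /=; apply: eq_bigr => k _.
have kN : k + j <= N by rewrite (leq_trans _ njN) // leq_add2r -ltnS.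
rewrite -(moment_ffact kN) /moment big_distrl /=; apply: eq_bigr => i _.
by rewrite -!mulnA; congr (_ * (_ * _)); rewrite mulnC.
Qed.

Lemma num_colorings0 (G : sgraph) : 0 < #|G| -> num_colorings G 0 = 0.
Proof.
move=> G_gt0; apply/eqP; rewrite cards_eq0; apply/eqP/setP=> P; rewrite !inE.
apply/negbTE/negP => /and3P[/and3P[/eqP + _ _] /eqP/cards0_eq P0 _].
by rewrite P0 /cover big_set0 => /esym/eqP; rewrite -cards_eq0 cardsT gtn_eqF.
Qed.

Lemma moment_colorings (G : sgraph) (N : nat) : 0 < #|G| <= N ->
  moment N (colorings G) = N`! * total_colorings G.
Proof.
move=> /andP[G_gt0 leGN].
have -> : total_colorings G = \sum_(k < #|G|.+1) num_colorings G k.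
  by rewrite -(big_mkord xpredT (num_colorings G)) big_ltn // num_colorings0.
rewrite -(@moment_sum_ffact _ _ 0) ?addn0 //; apply: eq_moment => x.
by rewrite colorings_ffact; apply: eq_bigr => k _; rewrite addn0.
Qed.

(** From [x * x ^_ k = x ^_ k.+1 + k * x ^_ k]: the first term contributes [total_colorings], the
    second [total_colors]. *)
Lemma moment_mul_colorings (G : sgraph) (N : nat) : 0 < #|G| < N ->
  moment N (fun x => x * colorings G x) = N`! * (total_colorings G + total_colors G).
Proof.
move=> /andP[G_gt0 ltGN].
have -> : total_colorings G = \sum_(k < #|G|.+1) num_colorings G k.
  by rewrite -(big_mkord xpredT (num_colorings G)) big_ltn // num_colorings0.
have -> : total_colors G = \sum_(k < #|G|.+1) k * num_colorings G k.
  by rewrite -(big_mkord xpredT (fun k => k * num_colorings G k)) big_ltn.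
rewrite mulnDr -(@moment_sum_ffact _ _ 1) ?addn1 //.
rewrite -(@moment_sum_ffact _ _ 0 (fun k => k * num_colorings G k)) ?addn0 1?ltnW // -momentD.
apply: eq_moment => x; rewrite colorings_ffact big_distrr -big_split /=.
apply: eq_bigr => k _; rewrite addn0 addn1.
rewrite [k * _]mulnC -mulnA -mulnDr mulnCA; congr (_ * _).
have [lekx|/ffact_small x0] := leqP k x; last by rewrite ffactnSr x0 !muln0.
by rewrite ffactnSr [x ^_ k * _]mulnC -mulnDl subnK.
Qed.

Lemma avg_colors_mean (G : sgraph) (N : nat) (d : seq nat) :
    0 < #|G| < N -> colorings G =1 root_prod d -> all (ltn^~ N) d ->
  avg_colors G = (mean N d - 1)%R.
Proof.
move=> GN Gd dN; have [G_gt0 ltGN] := andP GN.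
have M0 : 0 < moment N (root_prod d) by rewrite moment_gt0 // root_prod_gt0.
have E0 := eq_moment N Gd; rewrite moment_colorings ?G_gt0 1?ltnW // in E0.
have E1 := @eq_moment N (fun x => x * colorings G x) (fun x => x * root_prod d x).
rewrite moment_mul_colorings // in E1; rewrite /mean -E1; last by move=> x; rewrite Gd.
rewrite -{}E0 muln_gt0 in M0 *; have /andP[N0 B0] := M0.
have Nneq0 : (N`!%:R != 0 :> rat)%R by rewrite pnatr_eq0 -lt0n.
have Bneq0 : ((total_colorings G)%:R != 0 :> rat)%R by rewrite pnatr_eq0 -lt0n.
by rewrite /avg_colors !natrM natrD; field; apply/andP.
Qed.

(** * Perfect elimination orderings *)

Section Elimination.

Variable G : sgraph.
Implicit Types (v : G) (s t : seq G).

Definition nclique s := pairwise (@adj G) s.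

(** Perfect elimination ordering; the head is eliminated first. *)
Fixpoint peo s :=
  if s is v :: s' then nclique (filter (adj v) s') && peo s' else true.

Fixpoint degs s :=
  if s is v :: s' then size (filter (adj v) s') :: degs s' else [::].

Lemma size_degs s : size (degs s) = size s.
Proof. by elim: s => //= v s ->. Qed.

Lemma exists_peo : triangulated G ->
  exists s : seq G, [/\ uniq s, s =i G & peo s].
Proof.
move=> Gtri.
suff H m (A : {set G}) : #|A| = m -> exists s : seq G, [/\ uniq s, s =i A & peo s].
  have [s [us sA ps]] := H _ [set: G] erefl.
  by exists s; split=> // x; rewrite sA inE.
elim: m A => [|m IHm] A cardA.
  by exists [::]; split=> // x; rewrite (cards0_eq cardA) inE.
have A0 : A != set0 by rewrite -card_gt0 cardA.
have [[v vA] /forall_inP sv] := Gtri A A0.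
have [|s [us sA ps]] := IHm (A :\ v); first by move: cardA; rewrite (cardsD1 v) vA => -[].
exists (v :: s); split=> /=; first by rewrite us sA !inE eqxx.
  by move=> x; rewrite inE sA !inE; case: eqP => [->|].
rewrite ps andbT /nclique.
(* [clique] only speaks of distinct vertices; distinctness is supplied by the uniqueness of the
   sequence. *)
apply: (@sub_in_pairwise _ (mem (filter (adj v) s)) (fun x y => x != y)); last first.
- by rewrite -uniq_pairwise filter_uniq.
- by apply/allP.
move=> x y /=; rewrite !mem_filter !sA !inE.
move=> /andP[vx /andP[_ xA]] /andP[vy /andP[_ yA]] xy.
have /(_ (exist (fun x => is_true (x \in A)) x xA)) := sv.
rewrite inE /= => /(_ vx)/forall_inP/(_ (exist (fun x => is_true (x \in A)) y yA)).
by rewrite inE => /(_ vy)/implyP; apply; rewrite -val_eqE.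
Qed.

(** The coloring stays total on [G], with free colors outside [s], so that no induced subgraph is
    needed along the elimination. *)
Definition proper_on s x (c : {ffun G -> 'I_x}) :=
  pairwise (fun u v => adj u v ==> (c u != c v)) s.
Arguments proper_on : simpl never.

Lemma nclique_colors_uniq s x (c : {ffun G -> 'I_x}) :
  nclique s -> proper_on s c -> uniq (map c s).
Proof.
move=> cs pc; rewrite uniq_pairwise pairwise_map.
have : pairwise (fun u v => adj u v && (adj u v ==> (c u != c v))) s.
  by rewrite (pairwise_relI (@adj G)); apply/andP.
by apply: sub_pairwise => u v /= /andP[-> ].
Qed.

Definition recolor x (c : {ffun G -> 'I_x}) v (a : 'I_x) : {ffun G -> 'I_x} :=
  [ffun u => if u == v then a else c u].

Lemma proper_on_recolor s x (c : {ffun G -> 'I_x}) v a :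
  v \notin s -> proper_on s (recolor c v a) = proper_on s c.
Proof.
move=> vs; apply: (@eq_in_pairwise _ (mem s)); last by apply/allP.
move=> u w /= us ws; rewrite !ffunE.
by rewrite (negbTE (memPn vs u us)) (negbTE (memPn vs w ws)).
Qed.

Lemma proper_on_cons s x (c : {ffun G -> 'I_x}) v : v \notin s ->
  proper_on (v :: s) c = (c v \notin map c (filter (adj v) s)) && proper_on s c.
Proof.
move=> vs; rewrite /proper_on pairwise_cons; congr (_ && _).
apply/allP/idP => [H | /mapP H u us]; first apply/mapP => -[u].
  by rewrite mem_filter => /andP[vu us] cE; have /implyP/(_ vu) := H u us; rewrite cE eqxx.
apply/implyP => vu; apply/negP => /eqP cE; apply: H; exists u => //.
by rewrite mem_filter vu.
Qed.

Definition colorings_on s x := #|[set c : {ffun G -> 'I_x} | proper_on s c]|.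

(* Exchanging the color of [v] with the extra color [a] is an involution of the
   pairs [(c, a)], and turns extensions of a coloring of [s] to [v] into
   colorings of [v :: s] together with a free color. *)
Lemma colorings_on_cons s v x : v \notin s -> nclique (filter (adj v) s) ->
  x * colorings_on (v :: s) x = (x - size (filter (adj v) s)) * colorings_on s x.
Proof.
move=> vs cl.
pose swap (p : {ffun G -> 'I_x} * 'I_x) := (recolor p.1 v p.2, p.1 v).
have swapK : involutive swap.
  case=> c a; rewrite /swap /= ffunE eqxx; congr (_, _).
  by apply/ffunP => u; rewrite !ffunE; case: eqP => [->|].
transitivity #|[set p : {ffun G -> 'I_x} * 'I_x | proper_on (v :: s) p.1]|.
  rewrite /colorings_on mulnC -[x in _ * x]card_ord -cardsT -cardsX.
  by apply: eq_card => -[c a]; rewrite !inE andbT.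
transitivity #|[set p | proper_on (v :: s) (swap p).1]|.
  rewrite -(card_imset _ (inv_inj swapK)); apply: eq_card => p.
  by rewrite -[p in LHS]swapK mem_imset ?inE ?swapK //; apply: inv_inj.
transitivity (\sum_(c : {ffun G -> 'I_x} | proper_on s c) \sum_(a | a \notin map c (filter (adj v) s)) 1).
  rewrite -sum1_card pair_big_dep /=; apply: eq_bigl => -[c a].
  rewrite !inE proper_on_cons //= proper_on_recolor // andbC ffunE eqxx.
  congr (_ && (_ \notin _)); apply/eq_in_map => u; rewrite mem_filter => /andP[_ us].
  by rewrite ffunE (negbTE (memPn vs u us)).
transitivity (\sum_(c : {ffun G -> 'I_x} | proper_on s c) (x - size (filter (adj v) s))).
  apply: eq_bigr => c pc; rewrite sum1_card.
  have /card_uniqP : uniq (map c (filter (adj v) s)).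
    apply: nclique_colors_uniq => //; apply: subseq_pairwise pc.
    exact: filter_subseq.
  rewrite size_map => <-.
  have := cardC (mem (map c (filter (adj v) s))); rewrite card_ord => cx.
  by rewrite -[X in X - _]cx addKn.
by rewrite sum_nat_const mulnC /colorings_on; congr (_ * _); apply: eq_card => c; rewrite inE.
Qed.

(** In [H], the powers of [x] account for the free colors of the vertices outside [t]; for [t = s]
    they cancel when [x] is positive. *)
Lemma colorings_peo s : uniq s -> s =i G -> 0 < #|G| -> peo s ->
  colorings G =1 root_prod (degs s).
Proof.
move=> us sG G_gt0 ps x.
have H t : uniq t -> peo t ->
    x ^ size t * colorings_on t x = root_prod (degs t) x * x ^ #|G|.
  elim: t => [_ _|v t IHt /= /andP[vt ut] /andP[cl pt]].
    rewrite /root_prod big_nil !mul1n -[x in RHS]card_ord -card_ffun.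
    by apply: eq_card => c; rewrite inE.
  rewrite expnS -mulnA mulnCA colorings_on_cons // mulnCA IHt //.
  by rewrite /root_prod big_cons mulnA.
have -> : colorings G x = colorings_on s x.
  apply: eq_card => c; rewrite !inE /proper_on pairwise_all2rel => [|u|u w]; last first.
  - by rewrite adj_sym eq_sym.
  - by rewrite adj_irr.
  apply/forallP/allrelP => [pc u w _ _|pc u]; first by have /forallP := pc u.
  by apply/forallP => w; apply: pc; rewrite sG.
have sizeG : size s = #|G| by rewrite -(card_uniqP us); apply: eq_card.
(* At [x = 0] the cancellation fails, but a nonempty graph has no coloring and every truncated
   factor is zero. *)
have [->|x_gt0] := posnP x.
  have [v _] := card_gt0P G_gt0.
  have -> : colorings_on s 0 = 0.
    by apply/eqP; rewrite cards_eq0; apply/eqP/setP => c; case: (c v).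
  apply/esym/eqP; rewrite -leqn0 leqNgt root_prod_gt0.
  by case: (s) sizeG => [/esym/eqP|]; rewrite ?gtn_eqF.
have := H s us ps; rewrite sizeG mulnC => /eqP.
by rewrite eqn_pmul2r ?expn_gt0 ?x_gt0 // => /eqP.
Qed.

End Elimination.

(** * Degrees along an elimination ordering: cliques, contiguity, edge count *)

Definition contiguous (d : seq nat) := forall x y, y \in d -> x < y -> x \in d.

Section EliminationDegrees.

Variable G : sgraph.
Implicit Types (v : G) (s t : seq G).

(** If the head [v] of [s] lies in [t], the rest of [t] sits in the clique of later neighbors of
    [v]. Either [k] is the degree of [v], or [k] is smaller than the size of that clique and
    induction applies to it. *)
Lemma nclique_degs s t k :
  peo s -> subseq t s -> nclique t -> k < size t -> k \in degs s.
Proof.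
elim: s t => [|v s IHs] t; first by case: t.
move=> /= /andP[cl ps] ts ct kt.
have [vt|vt] := boolP (v \in t); last first.
  rewrite inE (IHs t) ?orbT //.
  by case: t ts vt {ct kt} => [|w t]; rewrite ?sub0seq //= inE; case: (w =P v) => [->|//]; rewrite eqxx.
case: t ts vt ct kt => // w t /=; case: (w =P v) => [->|wv]; last first.
  move=> ts _ ct kt; rewrite inE (IHs (w :: t)) ?orbT //.
move=> ts _ /andP[/allP vt ct]; rewrite ltnS => kt.
have tf : subseq t (filter (adj v) s).
  by rewrite subseq_filter ts andbT; apply/allP.
have fs := filter_subseq (adj v) s.
have := size_subseq tf; rewrite leq_eqVlt => /orP[/eqP tE|lt_t].
  move: kt; rewrite inE tE leq_eqVlt => /orP[->//|kt]; rewrite (IHs _ ps fs cl kt) orbT //.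
by rewrite inE (IHs _ ps fs cl) ?orbT // (leq_ltn_trans kt).
Qed.

(** The clique is a vertex together with its later neighbors. *)
Lemma degs_nclique s k : peo s -> k \in degs s ->
  exists t, [/\ subseq t s, nclique t & size t = k.+1].
Proof.
elim: s => //= v s IHs /andP[cl ps]; rewrite inE => /orP[/eqP ->|/(IHs ps)[t [ts ct st]]].
  exists (v :: filter (adj v) s); split=> //=; first by rewrite eqxx filter_subseq.
  by apply/andP; split=> //; apply/allP => w; rewrite mem_filter => /andP[].
exists t; split=> //; exact: (subseq_trans ts (subseq_cons s v)).
Qed.

Lemma degs_contiguous s : peo s -> contiguous (degs s).
Proof.
move=> ps x y /(degs_nclique ps)[t [ts ct st]] xy.
by apply: (nclique_degs ps ts ct); rewrite st ltnW.
Qed.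

Lemma degs_lt s : {in degs s, forall d, d < size s}.
Proof.
elim: s => //= v s IHs d; rewrite inE => /orP[/eqP -> | /IHs/ltnW //].
by rewrite ltnS size_filter count_size.
Qed.

Lemma size_elimination s : uniq s -> s =i G -> size s = #|G|.
Proof. by move=> us sG; rewrite -(card_uniqP us); apply: eq_card. Qed.

Lemma all_degs_lt s N : uniq s -> s =i G -> #|G| <= N -> all (ltn^~ N) (degs s).
Proof.
move=> us sG GN; apply/allP => d /degs_lt; rewrite size_elimination // => dG.
exact: leq_trans dG GN.
Qed.

(** A head adjacent to [v] has a nonzero entry and adds one neighbor. If [v] is itself the head, its
    first later neighbor [w] is adjacent to all the others, so the bound for [w] leaves room for one
    more. *)
Lemma degree_le_degs s v : uniq s -> peo s -> v \in s ->
  size (filter (adj v) s) <= count (leq 1) (degs s).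
Proof.
elim: s v => //= u s IHs v /andP[us uqs] /andP[cl ps].
rewrite inE; case: eqP => [-> _|vu /= vs].
  rewrite adj_irr; case E: (filter (adj u) s) => [//|w t] /=.
  rewrite add1n ltnS; have ws : w \in filter (adj u) s by rewrite E mem_head.
  apply: leq_trans (IHs w uqs ps _); last by move: ws; rewrite mem_filter => /andP[].
  apply: uniq_leq_size.
    by have := filter_uniq (adj u) uqs; rewrite E => /andP[].
  move=> z zt; rewrite mem_filter.
  move: cl; rewrite E /nclique pairwise_cons => /andP[/allP/(_ z zt) -> _].
  have : z \in filter (adj u) s by rewrite E inE zt orbT.
  by rewrite mem_filter => /andP[].
have {IHs}IHs := IHs v uqs ps vs.
case: ifP => [vu_adj|_]; last by rewrite (leq_trans IHs) // leq_addl.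
rewrite /= -add1n leq_add // lt0b size_filter -has_count.
by apply/hasP; exists v; rewrite // adj_sym.
Qed.

(** Each edge is counted once in [degs], at its earlier endpoint, and twice in the double sum. *)
Lemma sum_adj_degs s : uniq s ->
  \sum_(u <- s) \sum_(v <- s) adj u v = (sumn (degs s)).*2.
Proof.
elim: s => [|u s IHs] /=; first by rewrite big_nil.
move=> /andP[us uqs]; rewrite big_cons big_cons adj_irr add0n.
under [X in _ + X]eq_bigr => w _ do rewrite big_cons.
rewrite big_split /= IHs // doubleD addnA; congr (_ + _).
under [X in _ + X]eq_bigr => w _ do rewrite adj_sym.
by rewrite addnn -big_mkcond /= sum1_count size_filter.
Qed.

Lemma sum_adj s : uniq s -> s =i G ->
  \sum_(u : G) \sum_(v : G) adj u v = (sumn (degs s)).*2.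
Proof.
move=> us sG; rewrite -(sum_adj_degs us).
have big_s (F : G -> nat) : \sum_(u : G) F u = \sum_(u <- s) F u.
  by rewrite (big_uniq _ us); apply: eq_bigl => u; rewrite sG.
by rewrite big_s; apply: eq_bigr => u _; rewrite big_s.
Qed.

End EliminationDegrees.

(** * Lowering the degrees to those of the extremal graphs *)

(** The kept block [b] already contains everything below each entry of [e], so [mean_lt] allows the
    entries of [e] to drop straight to 0 one after another. *)
Lemma mean_zeros (N : nat) (b e : seq nat) :
    all (ltn^~ N) (e ++ b) -> {in e, forall x, {subset iota 0 x <= b}} ->
  (mean N.+2 (nseq (size e) 0 ++ b) <= mean N.+2 (e ++ b) ?= iff (sumn e == 0))%R.
Proof.
elim: e b => [|x e IHe] b eN eb /=; first by apply/leifP; rewrite eqxx.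
have zb : mean N.+2 (0 :: nseq (size e) 0 ++ b) = mean N.+2 (nseq (size e) 0 ++ 0 :: b).
  by apply: perm_mean; rewrite -[_ :: (_ ++ b)]cat1s perm_catCA.
have ze : mean N.+2 (e ++ 0 :: b) = mean N.+2 (0 :: e ++ b).
  by apply: perm_mean; rewrite -[0 :: b]cat1s perm_catCA.
have IH : (mean N.+2 (nseq (size e) 0 ++ 0 :: b) <= mean N.+2 (0 :: e ++ b) ?= iff (sumn e == 0))%R.
  rewrite -ze; apply: IHe => [|y ye z zy].
    move: eN; rewrite /= !all_cat /= => /andP[xN /andP[-> ->]]; rewrite andbT.
    exact: leq_ltn_trans xN.
  by rewrite inE (eb y) ?orbT // inE ye orbT.
have [->|x_gt0] := posnP x; first by rewrite zb.
rewrite addn_eq0 gtn_eqF //= zb.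
apply/leifP; apply: le_lt_trans (IH).1 _; apply: mean_lt => //.
by move=> z /(eb x (mem_head _ _)) zb'; rewrite mem_cat zb' orbT.
Qed.

Lemma leq_count_sumn (d : seq nat) : count (leq 1) d <= sumn d.
Proof. by elim: d => //= y d IHd; rewrite leq_add //; case: y. Qed.

(** A sum not exceeding the number of nonzero entries forces all entries to be at most 1. *)
Lemma perm_zeros_ones (d : seq nat) : sumn d <= count (leq 1) d ->
  perm_eq (nseq (size d - sumn d) 0 ++ nseq (sumn d) 1) d.
Proof.
elim: d => //= y d IHd; have cd := leq_count_sumn d; have cs := count_size (leq 1) d.
case: y => [|[|y]] sd; last by move: sd; lia.
  have {}sd : sumn d <= count (leq 1) d by [].
  by rewrite subSn ?perm_cons ?IHd // (leq_trans sd).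
have {}sd : sumn d <= count (leq 1) d by [].
rewrite subSS -[nseq (1 + _) 1]/([:: 1] ++ nseq (sumn d) 1) perm_catCA /= perm_cons.
exact: IHd.
Qed.

(** Induction on the sum: as long as it exceeds [D], a largest entry is decremented, which strictly
    lowers the mean. When it equals [D], only zeros and ones remain. *)
Lemma mean_ones (N D : nat) (d : seq nat) :
    all (ltn^~ N) d -> contiguous d -> D <= count (leq 1) d ->
  (mean N.+2 (nseq (size d - D) 0 ++ nseq D 1) <= mean N.+2 d ?= iff (sumn d == D))%R.
Proof.
have [m] := ubnP (sumn d); elim: m d => // m IHm d; rewrite ltnS => dm dN dc dD.
have := leq_trans dD (leq_count_sumn d); rewrite leq_eqVlt => /orP[/eqP DE|ltDd].
  by apply/leifP; rewrite -DE eqxx DE (perm_mean _ (perm_zeros_ones _)) -?DE.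
apply/leifP; rewrite gtn_eqF //.
(* Lowering a largest entry keeps [d] contiguous. *)
pose y := \max_(i <- d) i.
have dy z : z \in d -> z <= y by move=> zd; apply: (@leq_bigmax_seq _ _ xpredT id).
have yd : y \in d.
  have : d != [::] by case: (d) ltDd.
  rewrite /y; elim: (d) => // a e IHe _; rewrite big_cons.
  have [->|/IHe ye] := eqVneq e [::]; first by rewrite big_nil maxn0 mem_head.
  by rewrite inE /maxn; case: ifP; rewrite ?ye ?orbT // eqxx.
have y_gt0 : 0 < y.
  rewrite lt0n; apply: contraTneq ltDd => y0; rewrite -leqNgt.
  suff -> : sumn d = 0 by [].
  by apply/eqP; rewrite sumnE big_seq big1 // => i /dy; rewrite y0 leqn0 => /eqP.
have dq := perm_to_rem yd; set q := rem y d in dq.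
have qE z : z < y -> z \in q.
  move=> zy; have := dc _ _ yd zy; rewrite (perm_mem dq) inE ltn_eqF //.
have qy z : z \in q -> z <= y by move=> zq; apply: dy; rewrite (perm_mem dq) inE zq orbT.
have sq : size d = size (y.-1 :: q) by rewrite (perm_size dq).
have sumq : sumn d = (sumn (y.-1 :: q)).+1.
  by rewrite (perm_sumn dq) /= -addSn prednK.
have yqN : all (ltn^~ N) (y :: q) by rewrite -(perm_all _ dq).
have /andP[yN qN] := yqN.
rewrite sq; apply: le_lt_trans (_ : mean N.+2 (y.-1 :: q) < _)%R; last first.
  rewrite (perm_mean _ dq); apply: mean_lt; rewrite ?ltn_predL //.
  by move=> z; rewrite mem_iota => /andP[_ zy]; apply: qE.
apply: IHm.
- by rewrite -ltnS -sumq.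
- by apply/andP; split=> //; apply: leq_ltn_trans (leq_pred y) yN.
- move=> a z; rewrite inE => zq az; rewrite inE qE ?orbT //.
  case/orP: zq => [/eqP zE|/qy]; last exact: leq_trans.
  by rewrite zE in az; apply: leq_trans az (leq_pred _).
have cq : count (leq 1) d = (count (leq 1) q).+1.
  by have /permP -> := dq; rewrite /= y_gt0.
(* Decrementing [y >= 2] preserves the number of nonzero entries. If [y = 1], that number equals the
   sum, which exceeds [D], so one of them can be lost. *)
rewrite /=; have [y2|y1] := ltnP 1 y.
  by move: y2 dD; rewrite cq; case: (y) => [|[|]].
suff : sumn d <= count (leq 1) d by move: ltDd; rewrite cq; lia.
have : all (leq^~ 1) d by apply/allP => z /dy/leq_trans; apply.
by elim: (d) => //= a e IHe /andP[a1 /IHe ae]; rewrite leq_add //; case: a a1 => [|[]].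
Qed.

(** * The extremal graphs *)

Lemma peo_disjoint_union (G H : sgraph) (s : seq G) (t : seq H) :
    peo s -> peo t ->
  @peo (disjoint_union G H) (map inr t ++ map inl s).
Proof.
move=> ps; elim: t => [_|v t IHt /= /andP[cl pt]].
  elim: s ps => //= u s IHs /andP[cl /IHs ->]; rewrite andbT.
  by rewrite filter_map /nclique pairwise_map.
rewrite IHt // andbT filter_cat !filter_map.
rewrite [X in _ ++ map _ X](eq_filter (a2 := pred0)) // filter_pred0 cats0.
by rewrite /nclique pairwise_map.
Qed.

Lemma degs_disjoint_union (G H : sgraph) (s : seq G) (t : seq H) :
  @degs (disjoint_union G H) (map inr t ++ map inl s) = degs t ++ degs s.
Proof.
elim: t => [|v t IHt] /=.
  by elim: s => //= u s ->; rewrite filter_map size_map.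
rewrite IHt filter_cat !filter_map size_cat !size_map; congr (_ :: _).
by rewrite [filter _ s](eq_filter (a2 := pred0)) // filter_pred0 addn0.
Qed.

Lemma elimination_disjoint_union (G H : sgraph) (s : seq G) (t : seq H) :
    uniq s -> s =i G -> uniq t -> t =i H ->
  uniq (map inr t ++ map inl s : seq (disjoint_union G H)) /\
  (map inr t ++ map inl s : seq (disjoint_union G H)) =i disjoint_union G H.
Proof.
move=> us sG ut tH; split.
  rewrite cat_uniq !map_inj_uniq ?us ?ut ?andbT //=; try by move=> ? ? [].
  by apply/hasPn => _ /mapP[u _ ->]; apply/mapP => -[].
case=> u; rewrite mem_cat.
  by apply/orP; right; apply: map_f; rewrite sG.
by apply/orP; left; apply: map_f; rewrite tH.
Qed.

Lemma complete_degs (n : nat) (s : seq (complete n)) : uniq s ->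
  peo s /\ degs s = rev (iota 0 (size s)).
Proof.
elim: s => //= u s IHs /andP[us uqs]; have [ps ->] := IHs uqs.
have -> : filter [eta (fun x y : 'I_n => x != y) u] s = s.
  by apply/all_filterP/allP => w ws; apply: contraNneq us => ->.
rewrite ps /nclique andbT -uniq_pairwise; split=> //.
by rewrite -[0 :: _]/(iota 0 (size s).+1) -addn1 iotaD rev_cat.
Qed.

Lemma edgeless_degs (n : nat) (s : seq (edgeless n)) :
  peo s /\ degs s = nseq (size s) 0.
Proof. by elim: s => //= u s [ps ->]; rewrite filter_pred0 ps. Qed.

(** The center is eliminated last, so each leaf still sees exactly it. *)
Lemma star_degs (n : nat) (s : seq 'I_n) :
  let t := map inr s ++ [:: inl ord0] : seq (complete_bipartite 1 n) in
  peo t /\ degs t = nseq (size s) 1 ++ [:: 0].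
Proof.
elim: s => //= u s [ps ->]; rewrite ps filter_cat filter_map.
by rewrite (eq_filter (a2 := pred0)) //= filter_pred0.
Qed.

(** * Isomorphisms and recognition of the extremal graphs *)

Lemma isomorphic_sym (G H : sgraph) : isomorphic G H -> isomorphic H G.
Proof.
move=> [f [g fK gK] fadj]; exists g; first by exists f.
by move=> x y; rewrite -fadj !gK.
Qed.

Lemma isomorphic_colorings (G H : sgraph) : isomorphic G H -> colorings G =1 colorings H.
Proof.
suff le G' H' x : isomorphic G' H' -> colorings H' x <= colorings G' x.
  by move=> iGH x; apply/eqP; rewrite eqn_leq !le //; apply: isomorphic_sym.
move=> [f [g fK gK] fadj].
pose h (c : {ffun H' -> 'I_x}) : {ffun G' -> 'I_x} := [ffun u => c (f u)].
have h_inj : injective h.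
  move=> c d /ffunP cd; apply/ffunP => u.
  by have := cd (g u); rewrite !ffunE gK.
rewrite /colorings -(card_imset _ h_inj); apply: subset_leq_card.
apply/subsetP => _ /imsetP[c + ->]; rewrite !inE => /forallP pc.
apply/forallP => u; apply/forallP => v; rewrite !ffunE -fadj.
by have /forallP := pc (f u).
Qed.

Lemma isomorphic_of_inj (G H : sgraph) (g : H -> G) :
  injective g -> #|H| = #|G| -> (forall x y, adj (g x) (g y) = adj x y) -> isomorphic G H.
Proof.
move=> g_inj HG gadj; apply: isomorphic_sym; exists g => //.
by apply: inj_card_bij; rewrite // HG.
Qed.

Lemma card_adj (G : sgraph) :
  #|[set p : G * G | adj p.1 p.2]| = \sum_(u : G) \sum_(v : G) adj u v.
Proof.
rewrite pair_big -sum1_card big_mkcond /=.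
by apply: eq_bigr => p _; rewrite inE; case: adj.
Qed.

(** An injective homomorphism between graphs with equally many edges hits every edge, so the
    vertices outside its image are isolated. *)
Lemma isomorphic_union_edgeless (G K : sgraph) (h : K -> G) :
    injective h -> (forall x y, adj x y -> adj (h x) (h y)) ->
    \sum_(u : G) \sum_(v : G) adj u v = \sum_(x : K) \sum_(y : K) adj x y ->
  isomorphic G (disjoint_union K (edgeless (#|G| - #|K|))).
Proof.
move=> h_inj hadj edges.
pose hh (p : K * K) := (h p.1, h p.2).
have hh_inj : injective hh by move=> [a b] [c d] [/h_inj -> /h_inj ->].
(* The images of the ordered edges of [K] are edges of [G], and the two sets have the same
   cardinality. *)
have EE : hh @: [set p | adj p.1 p.2] = [set p | adj p.1 p.2].
  apply/eqP; rewrite eqEcard card_imset // !card_adj edges leqnn andbT.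
  by apply/subsetP => _ /imsetP[p + ->]; rewrite !inE => /hadj.
have adjE u v : adj u v -> exists x y, [/\ u = h x, v = h y & adj x y].
  move=> uv; have : (u, v) \in hh @: [set p | adj p.1 p.2] by rewrite EE inE.
  by case/imsetP => [[x y]]; rewrite inE => xy [-> ->]; exists x, y.
have cardT : #|G| - #|K| = #|~: (h @: [set: K])|.
  by rewrite -(cardsC (h @: [set: K])) card_imset // cardsT addKn.
pose g (x : disjoint_union K (edgeless (#|G| - #|K|))) : G :=
  match x with
  | inl x => h x
  | inr j => enum_val (cast_ord cardT j)
  end.
have gr j x : h x <> g (inr j).
  move=> hx; have := enum_valP (cast_ord cardT j); rewrite -[enum_val _]/(g (inr j)) -hx.
  by rewrite inE imset_f.
apply: (@isomorphic_of_inj _ _ g).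
- move=> [x|i] [y|j] gxy.
  + by rewrite (h_inj _ _ gxy).
  + by case: (gr _ _ gxy).
  + by case: (gr _ _ (esym gxy)).
  + by move/enum_val_inj/cast_ord_inj: gxy => ->.
- by rewrite card_sum card_ord subnKC // -(card_imset _ h_inj) max_card.
- move=> [x|i] [y|j] /=.
  + apply/idP/idP => [/adjE[x' [y' [/h_inj -> /h_inj ->]]] // | ]; exact: hadj.
  + by apply/negP => /adjE[x' [y' [_ /esym/gr]]].
  + by apply/negP => /adjE[x' [y' [/esym/gr]]].
  + by apply/negP => /adjE[x' [y' [/esym/gr]]].
Qed.

Lemma avg_colors_peo (G : sgraph) (s : seq G) :
    0 < #|G| -> uniq s -> s =i G -> peo s ->
  avg_colors G = (mean #|G|.+2 (degs s) - 1)%R.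
Proof.
move=> G_gt0 us sG ps; apply: avg_colors_mean; first by rewrite G_gt0 ltnS ltnW.
  exact: colorings_peo.
by apply: all_degs_lt; rewrite // ltnW.
Qed.

(** Transfers a comparison of means to averages of colors. [C] is the equality condition on degrees,
    from which the isomorphism has to be built. *)
Lemma avg_colors_leif (G H : sgraph) (s : seq G) (t : seq H) (C : bool) :
    0 < #|G| -> #|H| = #|G| ->
    uniq s -> s =i G -> peo s -> uniq t -> t =i H -> peo t ->
    (mean #|G|.+2 (degs t) <= mean #|G|.+2 (degs s) ?= iff C)%R ->
    (C -> isomorphic G H) ->
  (avg_colors H <= avg_colors G)%R /\
  (avg_colors G = avg_colors H <-> isomorphic G H).
Proof.
move=> G_gt0 HG us sG ps ut tH pt [le_m eq_m] iso.
have H_gt0 : 0 < #|H| by rewrite HG.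
have aG := avg_colors_peo G_gt0 us sG ps.
have aH := avg_colors_peo H_gt0 ut tH pt.
split; first by rewrite aG aH HG lerB.
split=> [aGH | iGH].
  by apply: iso; rewrite -eq_m eq_sym -(inj_eq (addIr (-1)%R)) -aG aGH aH HG.
(* An isomorphism preserves [colorings], so [degs t] computes the average for [G] as well. *)
rewrite aH; apply: avg_colors_mean; first by rewrite HG G_gt0 ltnS ltnW.
  by move=> x; rewrite (isomorphic_colorings iGH) (colorings_peo ut tH H_gt0 pt).
by apply: all_degs_lt; rewrite // HG ltnW.
Qed.

(** * The three lower bounds and their equality cases *)

Section Extremal.

Variables (G : sgraph) (s : seq G).
Hypotheses (us : uniq s) (sG : s =i G) (ps : peo s) (G_gt0 : 0 < #|G|).

Let size_s : size s = #|G|.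
Proof. exact: size_elimination. Qed.

Let degs_ltG : all (ltn^~ #|G|) (degs s).
Proof. exact: all_degs_lt. Qed.

(** Colorability means that the chromatic polynomial is positive at [k], that is, that none of its
    truncated factors vanishes. *)
Lemma colorable_degs k : colorable G k = all (ltn^~ k) (degs s).
Proof.
rewrite -root_prod_gt0 -(colorings_peo us sG G_gt0 ps) /colorings card_gt0.
by apply/existsP/set0Pn => -[c pc]; exists c; rewrite inE in pc *.
Qed.

Lemma degs_lt_chromatic : all (ltn^~ (chromatic_number G)) (degs s).
Proof. by rewrite -colorable_degs /chromatic_number; case: ex_minnP. Qed.

(** For [k] below the chromatic number, non-colorability gives an entry at least [k], and contiguity
    gives [k] itself. *)
Lemma iota_chromatic_degs : {subset iota 0 (chromatic_number G) <= degs s}.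
Proof.
move=> k; rewrite mem_iota add0n /= => kchi.
have : ~~ colorable G k.
  apply: contraTN kchi; rewrite -leqNgt /chromatic_number.
  by case: ex_minnP => m _; apply.
rewrite colorable_degs => /allPn[y yd]; rewrite -leqNgt leq_eqVlt.
by case/orP => [/eqP -> // | ]; apply: degs_contiguous yd.
Qed.

Lemma chromatic_gt0 : 0 < chromatic_number G.
Proof.
have := degs_lt_chromatic; case E: (degs s) => [|d d'] /=.
  by move: G_gt0; rewrite -size_s -size_degs E.
by move=> /andP[+ _]; apply: leq_ltn_trans.
Qed.

(** The entries split into those of the complete graph and a remainder [e], which is lowered to
    zeros. *)
Lemma avg_colors_chromatic :
  let H := disjoint_union (complete (chromatic_number G))
                          (edgeless (#|G| - chromatic_number G)) in
  (avg_colors H <= avg_colors G)%R /\ (avg_colors G = avg_colors H <-> isomorphic G H).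
Proof.
set chi := chromatic_number G => H.
have [e de] : exists e, perm_eq (degs s) (iota 0 chi ++ e).
  have [|d sd /permPl pd] := (count_subseqP (iota 0 chi) (degs s)).1.
    move=> x; rewrite count_uniq_mem ?iota_uniq //.
    case xc : (x \in _) => //; rewrite -has_count has_pred1.
    exact: iota_chromatic_degs.
  have [e pe] := perm_to_subseq sd.
  by exists e; rewrite (perm_trans pe) // perm_cat2r perm_sym pd.
have se : size e = #|G| - chi.
  by rewrite -size_s -size_degs (perm_size de) size_cat size_iota addKn.
have chiG : chi <= #|G|.
  by rewrite -size_s -size_degs (perm_size de) size_cat size_iota leq_addr.
pose sK := enum 'I_chi : seq (complete chi).
pose sE := enum 'I_(#|G| - chi) : seq (edgeless (#|G| - chi)).
have usK : uniq sK := enum_uniq _; have usE : uniq sE := enum_uniq _.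
have sKK : sK =i complete chi by move=> x; rewrite mem_enum.
have sEE : sE =i edgeless (#|G| - chi) by move=> x; rewrite mem_enum.
have [pK dK] := complete_degs usK; have [pE dE] := edgeless_degs sE.
have [ut tH] := elimination_disjoint_union usK sKK usE sEE.
apply: (avg_colors_leif (C := sumn e == 0) _ _ us sG ps ut tH) => //.
- by rewrite card_sum !card_ord subnKC.
- exact: peo_disjoint_union.
- rewrite degs_disjoint_union dK dE !size_enum_ord -se.
  have pr : perm_eq (degs s) (e ++ rev (iota 0 chi)).
    by rewrite (perm_trans de) // perm_catC perm_cat2l perm_sym perm_rev.
  rewrite (perm_mean _ pr); apply: mean_zeros; first by rewrite -(perm_all _ pr).
  move=> x xe k; rewrite mem_rev !mem_iota /= => kx; apply: ltn_trans kx _.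
  have /allP := degs_lt_chromatic; apply.
  by rewrite (perm_mem de) mem_cat xe orbT.
move=> e0.
(* The entry [chi - 1] of [degs s] yields a clique of size [chi]; with [e] zero, it carries all the
   edges of [G]. *)
have [t [ts ct st]] : exists t, [/\ subseq t s, nclique t & size t = chi].
  rewrite -[chi]prednK ?chromatic_gt0 //; apply: (degs_nclique ps).
  by apply: iota_chromatic_degs; rewrite mem_iota /= add0n prednK ?chromatic_gt0.
have sz : size t == chi by apply/eqP.
pose h : complete chi -> G := tnth (Tuple sz).
have ut' : uniq t := subseq_uniq ts us.
have := @isomorphic_union_edgeless G (complete chi) h.
rewrite card_ord; apply.
- by apply/tuple_uniqP.
- have [v0 _] := card_gt0P G_gt0.
  move=> x y xy; rewrite /h !(tnth_nth v0) /=.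
  have /(pairwiseP v0) H' := ct.
  have lt (z : 'I_chi) : (z : nat) \in gtn (size t) by rewrite inE st /=.
  have : (x != y :> nat) by [].
  rewrite neq_ltn => /orP[xy'|yx]; first exact: H'.
  by rewrite adj_sym; apply: H'.
- rewrite (sum_adj us sG) (sum_adj usK sKK) dK size_enum_ord.
  have /perm_sumn -> := de; rewrite sumn_cat (eqP e0) addn0.
  by rewrite sumn_rev.
Qed.

Lemma degree_neighbors v : #|neighbors v| = size (filter (adj v) s).
Proof.
rewrite -(card_uniqP (filter_uniq _ us)); apply: eq_card => w.
by rewrite inE mem_filter sG andbT.
Qed.

(** By [degree_le_degs], at least [Delta] entries are nonzero, so [mean_ones] lowers the degrees to
    [Delta] ones and zeros elsewhere. *)
Lemma avg_colors_max_degree :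
  let H := disjoint_union (complete_bipartite 1 (max_degree G))
                          (edgeless (#|G| - max_degree G - 1)) in
  (avg_colors H <= avg_colors G)%R /\ (avg_colors G = avg_colors H <-> isomorphic G H).
Proof.
set Delta := max_degree G => H.
have [v vD] : {v : G | Delta = #|neighbors v|} 
  := @bigop.eq_bigmax G (fun v => #|neighbors v|) G_gt0.
have dv : #|neighbors v| <= count (leq 1) (degs s).
  by rewrite degree_neighbors degree_le_degs // sG.
have ltDG : Delta < #|G|.
  rewrite vD -[X in _ < X]cardsT (cardsD1 v [set: G]) inE add1n ltnS subset_leq_card //.
  apply/subsetP => w; rewrite !inE andbT => vw.
  by apply/eqP => wv; rewrite wv adj_irr in vw.
pose sK : seq (complete_bipartite 1 Delta) := map inr (enum 'I_Delta) ++ [:: inl ord0].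
pose sE := enum 'I_(#|G| - Delta - 1) : seq (edgeless (#|G| - Delta - 1)).
have usE : uniq sE := enum_uniq _.
have usK : uniq sK.
  rewrite cat_uniq map_inj_uniq ?enum_uniq /= ?orbF ?andbT; last by move=> ? ? [].
  by apply/mapP => -[].
have sKK : sK =i complete_bipartite 1 Delta.
  case=> x; rewrite mem_cat; apply/orP; first by right; rewrite ord1 mem_head.
  by left; rewrite map_f // mem_enum.
have sEE : sE =i edgeless (#|G| - Delta - 1) by move=> x; rewrite mem_enum.
have [pK dK] := star_degs (enum 'I_Delta); have [pE dE] := edgeless_degs sE.
have [ut tH] := elimination_disjoint_union usK sKK usE sEE.
apply: (avg_colors_leif (C := sumn (degs s) == Delta) _ _ us sG ps ut tH) => //.
- by rewrite !card_sum !card_ord; lia.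
- exact: peo_disjoint_union.
- rewrite degs_disjoint_union dK dE !size_enum_ord.
  have -> : mean #|G|.+2 (nseq (#|G| - Delta - 1) 0 ++ nseq Delta 1 ++ [:: 0]) =
            mean #|G|.+2 (nseq (size (degs s) - Delta) 0 ++ nseq Delta 1).
    apply: perm_mean; rewrite size_degs size_s.
    (* The additional zero is the entry of the star's center. *)
    have -> : nseq (#|G| - Delta) 0 = nseq (#|G| - Delta - 1) 0 ++ [:: 0].
      by rewrite -(nseqD _ 1); congr nseq; lia.
    by rewrite -catA perm_cat2l perm_catC.
  by apply: mean_ones => //; [apply: degs_contiguous | rewrite vD].
move/eqP => sD.
(* The star formed by a vertex [v] of maximum degree and its neighbors has [Delta] edges, which is
   the edge count of [G] in the equality case. *)
pose h (x : complete_bipartite 1 Delta) : G :=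
  match x with
  | inl _ => v
  | inr j => enum_val (cast_ord vD j)
  end.
have hr j : adj v (h (inr j)).
  by have := enum_valP (cast_ord vD j); rewrite inE.
have := @isomorphic_union_edgeless G (complete_bipartite 1 Delta) h.
rewrite card_sum !card_ord -subnDA [Delta + 1]addnC; apply.
- move=> [x|i] [y|j] hxy.
  + by rewrite !ord1.
  + by have := hr j; rewrite -hxy adj_irr.
  + by have := hr i; rewrite hxy adj_irr.
  + by move/enum_val_inj/cast_ord_inj: hxy => ->.
- by move=> [x|i] [y|j] // _; rewrite ?[adj (h (inr i)) _]adj_sym.
- rewrite (sum_adj us sG) (sum_adj usK sKK) dK sD.
  by rewrite sumn_cat sumn_nseq size_enum_ord mul1n addn0.
Qed.

(** The case [D = 0] of [mean_ones]; equality makes the edge count zero. *)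
Lemma avg_colors_edgeless :
  let H := edgeless #|G| in
  (avg_colors H <= avg_colors G)%R /\ (avg_colors G = avg_colors H <-> isomorphic G H).
Proof.
move=> H; pose sE := enum 'I_#|G| : seq (edgeless #|G|).
have usE : uniq sE := enum_uniq _.
have sEE : sE =i edgeless #|G| by move=> x; rewrite mem_enum.
have [pE dE] := edgeless_degs sE.
apply: (avg_colors_leif (C := sumn (degs s) == 0) _ _ us sG ps usE sEE) => //.
- by rewrite card_ord.
- have := @mean_ones #|G| 0 (degs s); rewrite subn0 cats0 size_degs size_s dE size_enum_ord.
  by apply=> //; apply: degs_contiguous.
move/eqP => s0; apply: (@isomorphic_of_inj _ _ (fun i : H => enum_val i)).
- exact: enum_val_inj.
- by rewrite card_ord.
- move=> x y; apply/negP => xy; have := sum_adj us sG; rewrite s0 -card_adj.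
  by move/eqP; rewrite cards_eq0 => /eqP/setP/(_ (enum_val x, enum_val y)); rewrite !inE xy.
Qed.

End Extremal.

Theorem theorem18 (G : sgraph) (n : nat) (hn : #|G| = n) (n_ge1 : 1 <= n)
    (Gtri : triangulated G) :
  let chi := chromatic_number G in
  let Delta := max_degree G in
  let H1 := disjoint_union (complete chi) (edgeless (n - chi)) in
  let H2 := disjoint_union (complete_bipartite 1 Delta)
                           (edgeless (n - Delta - 1)) in
  let H3 := edgeless n in
  [/\ (avg_colors H1 <= avg_colors G)%R /\
        (avg_colors G = avg_colors H1 <-> isomorphic G H1),
      (avg_colors H2 <= avg_colors G)%R /\
        (avg_colors G = avg_colors H2 <-> isomorphic G H2)
    & (avg_colors H3 <= avg_colors G)%R /\
        (avg_colors G = avg_colors H3 <-> isomorphic G H3)].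
Proof.
have [s [us sG ps]] := exists_peo Gtri; subst n.
split; first exact: (avg_colors_chromatic us sG ps n_ge1).
  exact: (avg_colors_max_degree us sG ps n_ge1).
exact: (avg_colors_edgeless us sG ps n_ge1).
Qed.
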